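(* No generalised convolution (in the sense of Urbanik), other than the classical convolution, is multinomial.
   Context: A generalised convolution in the sense of K. Urbanik is a binary operation $\cdot$ on the set of probability measures on $\mathbf{R}_+=[0,\infty)$ such that: $\cdot$ is associative and commutative; $\delta_0$ is a unit; $\cdot$ is distributive for convex sums, i.e. $(c\mu+(1-c)\nu)\cdot\lambda=c(\mu\cdot\lambda)+(1-c)(\nu\cdot\lambda)$ for $0\le c\le1$; $T_x(\mu\cdot\nu)=(T_x\mu)\cdot(T_x\nu)$ for $x>0$, where $T_x\mu$ is the image of $\mu$ under $y\mapsto xy$; if $\mu_n\to\mu$ and $\nu_n\to\nu$ weakly then $\mu_n\cdot\nu_n\to\mu\cdot\nu$ weakly; and there is a sequence of positive real numbers $c_n$ such that $T_{c_n}\delta_1^{\cdot n}$ converges weakly to a measure different from $\delta_0$ (here $\mu^{\cdot k}$ is the $k$-fold $\cdot$-product of $\mu$). The convolution $\cdot$ is called multinomial if for every probability measure $\mu$ on $\mathbf{R}_+$ with all moments $\mu_n$ finite, all $k\in\mathbf{N}$ and all $n$, the $n$-th moment of $\mu^{\cdot k}$ is $\sum_{n_1+\cdots+n_k=n}\frac{n!}{n_1!\cdots n_k!}\prod_{i=1}^k\mu_{n_i}$. *)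

(* Defs.v *)
From HB Require Import structures.
From mathcomp Require Import all_boot all_order all_algebra.
From mathcomp Require Import all_classical all_reals all_analysis.
From mathcomp Require Import measurable_realfun giry.

Set Implicit Arguments.
Unset Strict Implicit.
Unset Printing Implicit Defensive.

Import Order.TTheory GRing.Theory Num.Theory.
Import numFieldNormedType.Exports.

Local Open Scope classical_set_scope.
Local Open Scope ring_scope.

(* A probability measure on R_+ is a Borel probability measure on R that is
   concentrated on [0, +oo[.  Since a [probability] is a function on all
   subsets, the mathematical equality of measures is [≡μ] (agreement on the
   measurable sets), not Leibniz equality. *)
Record pprob (R : realType) := PProb {
  pprob_val :> probability R R ;
  pprobP : pprob_val `[0, +oo[%classic = 1%E }.

Section dirac_pprob.
Context {R : realType} (x : {nonneg R}).

Lemma pprob_dirac_subproof :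
  (\d_(x%:num : R) : probability R R)
    `[0, +oo[%classic = 1%E.
Proof.
by rewrite /= diracE mem_set//= in_itv/= andbT; apply: ge0.
Qed.

Definition pprob_dirac : pprob R := PProb pprob_dirac_subproof.

End dirac_pprob.

Section convex_sum.
Context {R : realType} (c : {i01 R}) (mu nu : pprob R).

Definition convex_measure : set R -> \bar R :=
  measure_add (mscale (c%:num)%:nng mu) (mscale (1 - c%:num)%:nng nu).

HB.instance Definition _ := Measure.on convex_measure.

Lemma convex_measureE A :
  convex_measure A = (c%:num%:E * mu A + (1 - c%:num)%:E * nu A)%E.
Proof. by rewrite /convex_measure measure_addE. Qed.

Lemma convex_measure_setT : convex_measure setT = 1%E.
Proof.
by rewrite convex_measureE !probability_setT !mule1 -EFinD addrC subrK.
Qed.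

HB.instance Definition _ :=
  Measure_isProbability.Build _ _ _ convex_measure convex_measure_setT.

Lemma pprob_convex_subproof :
  (convex_measure : probability R R) `[0, +oo[%classic = 1%E.
Proof. by rewrite /= convex_measureE !pprobP !mule1 -EFinD addrC subrK. Qed.

Definition pprob_convex : pprob R := PProb pprob_convex_subproof.

End convex_sum.

Section dilation.
Context {R : realType} (x : {posnum R}) (mu : pprob R).

Definition dilation (y : R) : R := x%:num * y.

Lemma measurable_dilation : measurable_fun setT dilation.
Proof. exact: mulrl_measurable. Qed.

HB.instance Definition _ :=
  isMeasurableFun.Build _ _ _ _ dilation measurable_dilation.

Lemma pprob_dilate_subproof :
  (distribution mu dilation : probability R R) `[0, +oo[%classic = 1%E.
Proof.
rewrite /= /distribution /pushforward -[RHS](pprobP mu); congr (_ _).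
apply/seteqP; split=> y /=; rewrite !in_itv/= !andbT /dilation pmulr_rge0//.
Qed.

(* T_x mu *)
Definition pprob_dilate : pprob R := PProb pprob_dilate_subproof.

End dilation.

Section classical_convolution.
Context {R : realType} (mu nu : pprob R).

Definition addxy (z : R * R) : R := z.1 + z.2.

Lemma measurable_addxy : measurable_fun setT addxy.
Proof. by apply: measurable_funD. Qed.

HB.instance Definition _ :=
  isMeasurableFun.Build _ _ _ _ addxy measurable_addxy.

Lemma classical_conv_subproof :
  (distribution (mu \x nu)%E addxy : probability R R)
    `[0, +oo[%classic = 1%E.
Proof.
apply/eqP; rewrite eq_le; apply/andP; split.
  by apply: probability_le1; exact: measurable_itv.
rewrite /= /distribution /pushforward.
have <- : (mu \x nu)%E (`[0, +oo[%classic `*` `[0, +oo[%classic) = 1%E.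
  rewrite product_measure1E; [|exact: measurable_itv..].
  rewrite [LHS](_ : _ = mu `[0%R, +oo[%classic * nu `[0%R, +oo[%classic)%E //.
  by rewrite !pprobP mule1.
apply: le_measure; rewrite ?inE.
- by apply: measurableX; exact: measurable_itv.
- by rewrite -[X in measurable X]setTI; exact: measurable_addxy.
- move=> [a b] [] /=; rewrite !in_itv/= !andbT.
  exact: addr_ge0.
Qed.

Definition classical_conv : pprob R := PProb classical_conv_subproof.

End classical_convolution.

(* The test functions are the bounded continuous functions on R_+. *)
Definition weak_cvg {R : realType} (mu_ : nat -> pprob R) (mu : pprob R) :=
  forall f : R -> R,
    {within `[0, +oo[%classic, continuous f} ->
    [bounded f x | x in `[0, +oo[%classic] ->
  (\int[mu_ n]_(x in `[0%R, +oo[) (f x)%:E)%E @[n --> \oo]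
    --> (\int[mu]_(x in `[0%R, +oo[) (f x)%:E)%E.

(* mu^{.k}, with mu^{.0} = delta_0 *)
Definition conv_pow {R : realType} (op : pprob R -> pprob R -> pprob R)
    (mu : pprob R) (k : nat) : pprob R :=
  iterop k op mu (pprob_dirac 0%:nng).

(* [gc_ext] says that [op] is an operation on measures, see [pprob]. *)
Record generalised_convolution {R : realType}
    (op : pprob R -> pprob R -> pprob R) : Prop := GeneralisedConvolution {
  gc_ext : forall mu mu' nu nu' : pprob R, mu ≡μ mu' -> nu ≡μ nu' ->
    op mu nu ≡μ op mu' nu' ;
  gc_assoc : forall mu nu rho : pprob R,
    op mu (op nu rho) ≡μ op (op mu nu) rho ;
  gc_comm : forall mu nu : pprob R, op mu nu ≡μ op nu mu ;
  gc_unit : forall mu : pprob R, op (pprob_dirac 0%:nng) mu ≡μ mu ;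
  gc_convex : forall (c : {i01 R}) (mu nu lambda : pprob R),
    op (pprob_convex c mu nu) lambda
      ≡μ pprob_convex c (op mu lambda) (op nu lambda) ;
  gc_dilate : forall (x : {posnum R}) (mu nu : pprob R),
    pprob_dilate x (op mu nu) ≡μ op (pprob_dilate x mu) (pprob_dilate x nu) ;
  gc_weak_cvg : forall (mu_ nu_ : nat -> pprob R) (mu nu : pprob R),
    weak_cvg mu_ mu -> weak_cvg nu_ nu ->
    weak_cvg (fun n => op (mu_ n) (nu_ n)) (op mu nu) ;
  gc_limit : exists (c : nat -> {posnum R}) (nu : pprob R),
    weak_cvg (fun n => pprob_dilate (c n)
                (conv_pow op (pprob_dirac 1%:nng) n)) nu
    /\ ~ nu ≡μ pprob_dirac 0%:nng }.

Definition moment {R : realType} (mu : pprob R) (n : nat) : \bar R :=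
  (\int[mu]_(x in `[0%R, +oo[) (x ^+ n)%:E)%E.

(* The index set {(n_1, ..., n_k) | n_1 + ... + n_k = n} is represented by the
   functions m : 'I_k -> {0, ..., n} whose values sum to n. *)
Definition multinomial_conv {R : realType}
    (op : pprob R -> pprob R -> pprob R) : Prop :=
  forall mu : pprob R, (forall n, moment mu n < +oo)%E ->
  forall k n : nat,
    moment (conv_pow op mu k) n =
    (\sum_(m : {ffun 'I_k -> 'I_n.+1} | (\sum_(i < k) m i == n)%N)
       (n`!%:R / \prod_(i < k) (m i)`!%:R
        * \prod_(i < k) fine (moment mu (m i))))%:E.

(* Main.v *)
Require Import Defs.
From mathcomp Require Import all_boot all_order all_algebra.
From mathcomp Require Import all_classical all_reals all_analysis.
From mathcomp Require Import giry.
From mathcomp Require Import measurable_realfun ring lra.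

(* Only the moments of order 1 and 2 of the products [mu . mu] are used.  For
   mu = (delta_a + delta_b) / 2 the distributivity of the convolution gives
   mu . mu = (delta_a . delta_a + 2 delta_a . delta_b + delta_b . delta_b) / 4,
   so the multinomial property, applied to mu, delta_a and delta_b, determines
   the first two moments of delta_a . delta_b: they are a + b and (a + b)^2.
   The variance vanishes, hence delta_a . delta_b = delta_{a+b}.  Both
   convolutions are distributive over convex sums and weakly continuous in each
   argument, and finitely supported measures are weakly dense, so they agree
   everywhere. *)

Set Implicit Arguments.
Unset Strict Implicit.
Unset Printing Implicit Defensive.

Import Order.TTheory GRing.Theory Num.Theory.
Import numFieldNormedType.Exports.
Import HBNNSimple.

Local Open Scope classical_set_scope.
Local Open Scope ring_scope.

(** * Induction over finitely supported measures *)

Section pprob_induction.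
Context {R : realType}.
Implicit Types mu nu : pprob R.

(** A measurable set containing [s] has mass 1, and one avoiding [s] is the complement of such a
    set. *)
Lemma pprob_eq_dirac mu (s : {nonneg R}) :
  mu [set s%:num] = 1%E -> mu ≡μ pprob_dirac s.
Proof.
have h A : measurable A -> A s%:num -> mu [set s%:num] = 1%E -> mu A = 1%E.
  move=> mA As mus; apply/eqP; rewrite eq_le probability_le1//= -mus.
  by apply: le_measure; rewrite ?inE// => x /= ->.
move=> mus A mA; rewrite /= diracE; have [As|As] := boolP (s%:num \in A).
  by apply: h => //; rewrite inE in As.
have := h _ (measurableC mA); rewrite probability_setC// => /(_ _ mus).
rewrite notin_setE in As => /(_ As)/eqP; rewrite -{2}(sube0 1%E).
have : mu A \is a fin_num by apply: fin_num_measure.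
case: (mu A) => //= r _; rewrite -EFinB eqe => /eqP h1; congr (_%:E).
lra.
Qed.

Lemma i01_exists (p : R) : 0 <= p <= 1 -> exists c : {i01 R}, c%:num = p.
Proof.
move=> p01; have pP : Itv.spec (@Itv.num_sem R) (Itv.Real `[0%Z, 1%Z]) p.
  by rewrite /= /Itv.num_sem/= in_itv/= p01 andbT ger0_real//; case/andP: p01.
by exists (Itv.mk pP).
Qed.

(** Induction on the list of support points. Unless all the mass sits at [a], the measure is a
    convex sum of the Dirac measure at [a] and of its conditioning on the complement of [a], which
    is carried by the shorter list. *)
Lemma pprob_finite_ind (P : pprob R -> Prop) :
  (forall mu nu, mu ≡μ nu -> P mu -> P nu) ->
  (forall a, P (pprob_dirac a)) ->
  (forall c mu nu, P mu -> P nu -> P (pprob_convex c mu nu)) ->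
  forall (s : seq {nonneg R}) mu, mu [set` [seq x%:num | x <- s]] = 1%E -> P mu.
Proof.
move=> Pext Pdirac Pconv; elim=> [|a s IH] mu.
  rewrite (_ : [set` _] = set0); last by apply/seteqP; split.
  by rewrite measure0 => /eqP; rewrite eqe eq_sym oner_eq0.
have -> : [set` [seq x%:num | x <- a :: s]] =
    [set a%:num : R] `|` [set` [seq x%:num | x <- s]].
  by apply/seteqP; split=> x /=; rewrite inE => /predU1P.
move=> mus.
have ms : measurable [set` [seq x%:num | x <- s]].
  apply: countable_measurable => //=.
  exact/finite_set_countable/finite_seq.
have [p mup] : exists p : R, mu [set a%:num] = p%:E.
  exists (fine (mu [set a%:num])); rewrite fineK//.
  by apply: fin_num_measure.
have p0 : 0 <= p by rewrite -lee_fin -mup.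
have p1 : p <= 1 by rewrite -lee_fin -mup probability_le1.
have [p1'|p1'] := eqVneq p 1.
  by apply: Pext (Pdirac a) => A mA; rewrite (@pprob_eq_dirac mu a)// mup p1'.
pose D := ~` [set a%:num : R].
have mD : measurable D by apply: measurableC.
have muD : mu D = (1 - p)%:E by rewrite /D probability_setC// mup.
(* The last argument of [mnormalize] is the fallback for a zero or infinite total mass, excluded
   here because [p] differs from 1. *)
pose q := mnormalize (mrestr mu mD) mu : probability R R.
have qE A : q A = (mu (A `&` D) * (1 - p)^-1%:E)%E.
  have muT : mrestr mu mD setT = (1 - p)%:E by rewrite /mrestr setTI.
  by rewrite /q /= /mnormalize /= muT eqe subr_eq0 eq_sym (negbTE p1').
(* Used twice: for R_+, and for the shorter list of support points. *)
have q1 A : measurable A -> mu (A `|` [set a%:num]) = 1%E -> q A = 1%E.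
  move=> mA muA; rewrite qE.
  have : mu (A `|` [set a%:num]) = (mu (A `&` D) + mu [set a%:num])%E.
    rewrite -measureU//; first by rewrite setUIl setvU setIT.
    - exact: measurableI.
    - by rewrite -setIA setICl setI0.
  have : mu (A `&` D) \is a fin_num.
    by apply: fin_num_measure; exact: measurableI.
  rewrite muA mup; case: (mu (A `&` D)) => //= r _ [r1].
  rewrite -EFinM; congr (_%:E); rewrite (_ : r = 1 - p); last lra.
  by rewrite divff// subr_eq0 eq_sym.
have qP : q `[0, +oo[%classic = 1%E.
  apply: q1 => //; apply/eqP; rewrite eq_le probability_le1/=; last first.
    exact: measurableU.
  rewrite -(pprobP mu); apply: le_measure; rewrite ?inE//; exact: measurableU.
have [c cE] : exists c : {i01 R}, c%:num = p by apply: i01_exists; rewrite p0.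
apply: (Pext (pprob_convex c (pprob_dirac a) (PProb qP))).
  move=> A mA; rewrite /= convex_measureE/= cE qE /= muleCA -!EFinM.
  rewrite divff ?mule1; last first.
    by rewrite subr_eq0 eq_sym.
  have -> : mu A = (mu (A `&` D) + mu (A `&` [set a%:num]))%E.
    rewrite -measureU//.
    - by rewrite -setIUr setvU setIT.
    - exact: measurableI.
    - exact: measurableI.
    - by rewrite setIACA setICl setI0.
  rewrite setI1 addeC indicE; case: (_ \in _); last by rewrite mulr0 measure0.
  by rewrite mulr1 mup.
apply: Pconv => //; apply: IH; apply: q1 => //.
by rewrite setUC.
Qed.

End pprob_induction.

(** * Weak density of finitely supported measures *)

Section density_of_finitely_supported_measures.
Context {R : realType}.
Implicit Types mu nu : pprob R.

Lemma nnsfun_distribution_subproof mu (g : {nnsfun R >-> R}) :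
  (distribution mu g : probability R R) `[0, +oo[%classic = 1%E.
Proof.
rewrite /= /distribution /pushforward -(probability_setT mu); congr (mu _).
by apply/seteqP; split => // x _ /=; rewrite in_itv/= andbT.
Qed.

Definition pprob_distribution mu (g : {nnsfun R >-> R}) : pprob R :=
  PProb (nnsfun_distribution_subproof mu g).

(** Composition with the absolute value keeps the values of [f] on R_+ and gives a function
    measurable on the whole line. *)
Lemma measurable_within_continuous_normr (f : R -> R) :
  {within `[0, +oo[%classic, continuous f} ->
  measurable_fun setT (fun x : R => f `|x|).
Proof.
move=> cf; apply: (@measurable_comp _ _ _ R R R `[0, +oo[%classic).
- exact: measurable_itv.
- by move=> _ [x _ <-] /=; rewrite in_itv/= normr_ge0.
- exact: subspace_continuous_measurable_fun.
- exact: normr_measurable.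
Qed.

Lemma pprob_setN mu : mu `]-oo, 0[%classic = 0%E.
Proof.
by rewrite -setCitvr probability_setC// pprobP subee.
Qed.

Lemma setTD_setN : [set: R] `\` `]-oo, 0[ = `[0, +oo[%classic.
Proof. by rewrite setTD setCitvl. Qed.

Lemma integral_pprob mu (f : R -> \bar R) : mu.-integrable setT f ->
  (\int[mu]_x f x = \int[mu]_(x in `[0%R, +oo[) f x)%E.
Proof.
move=> intf; rewrite -setTD_setN; apply: negligible_integral => //.
exact: pprob_setN.
Qed.

(** A change of variables turns the integrals into those of [f (g n x)] against [mu]; dominated
    convergence then applies, a bound of [f] being integrable. *)
Lemma weak_cvg_distribution mu (g : {nnsfun R >-> R}^nat) :
  (forall x, 0 <= x -> g n x @[n --> \oo] --> x) ->
  weak_cvg (fun n => pprob_distribution mu (g n)) mu.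
Proof.
move=> gcvg f cf [M [Mreal fM]].
have mf := measurable_within_continuous_normr cf.
(* [f] is only known to be measurable on R_+. *)
have fnorm nu : (\int[nu]_(x in `[0%R, +oo[) (f x)%:E =
    \int[nu]_(x in `[0%R, +oo[) (f `|x|)%:E)%E.
  apply: eq_integral => x; rewrite inE/= in_itv/= andbT => x0.
  by rewrite ger0_norm.
(* Boundedness provides a bound by each number strictly above [M], hence the added 1. *)
pose K := `|M| + 1.
have fK x : `|f `|x| | <= K.
  apply: (fM K); first by rewrite /K ltr_pwDr// ler_norm.
  by rewrite /= in_itv/= normr_ge0.
have gnorm n x : `|g n x| = g n x by rewrite ger0_norm.
have intfg n : mu.-integrable setT (EFin \o (fun x => f `|g n x|)).
  apply: measurable_bounded_integrable => //.
  - by rewrite [X in (X < _)%E](@probability_setT _ _ _ mu) ltry.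
  - exact: (measurableT_comp mf).
  - exists K; split=> [|L KL x _]; first exact: num_real.
    exact: le_trans (ltW KL).
have -> : (fun n =>
      \int[pprob_distribution mu (g n)]_(x in `[0%R, +oo[) (f x)%:E)%E =
    (fun n => \int[mu]_(x in `[0%R, +oo[) (f (g n x))%:E)%E.
  apply/funext => n; rewrite fnorm /= /distribution.
  rewrite integral_pushforward//=.
  - rewrite (_ : g n @^-1` `[0, +oo[ = setT); last first.
      by apply/seteqP; split => // x _ /=; rewrite in_itv/= andbT.
    rewrite -integral_pprob.
      by apply: eq_integral => x _; rewrite /= gnorm.
    by have := intfg n; under [X in EFin \o X]eq_fun do rewrite gnorm.
  - exact/measurable_EFinP.
  - rewrite (_ : g n @^-1` `[0, +oo[ = setT); first exact: intfg.
    by apply/seteqP; split => // x _ /=; rewrite in_itv/= andbT.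
have := @dominated_cvg _ _ _ mu `[0, +oo[%classic _
  (fun n x => (f (g n x))%:E) (EFin \o f) (fun=> K%:E).
apply => //.
- move=> n; apply: (measurable_funS measurableT) => //.
  apply/measurable_EFinP.
  rewrite (_ : (fun x => f (g n x)) = (fun x => f `|g n x|)).
    exact: (measurableT_comp mf).
  by apply/funext => x; rewrite gnorm.
- move=> x x0; apply: cvg_EFin; first by apply: nearW.
  (* Continuity at [x] is relative to R_+, where the values of the nonnegative function [g n]
     stay. *)
  move/subspace_continuousP : cf => /(_ _ x0); apply: cvg_comp => B /= xB.
  rewrite /= in_itv/= andbT in x0.
  have H : \forall n \near \oo, `[0, +oo[%classic (g n x) -> B (g n x).
    exact: (gcvg _ x0 _ xB).
  by apply: (@filterS _ _ _ _ _ _ H) => n /=; apply; rewrite in_itv/= andbT.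
- have := @finite_measure_integrable_cst _ _ _ mu `[0, +oo[%classic K.
  by apply; exact: measurable_itv.
- by move=> n x _; rewrite lee_fin -gnorm.
Qed.

(** Simple functions [g n] approximate the identity on R_+; their laws under [mu] are finitely
    supported and converge weakly to [mu]. *)
Lemma pprob_ind (P : pprob R -> Prop) :
  (forall mu nu, mu ≡μ nu -> P mu -> P nu) ->
  (forall a, P (pprob_dirac a)) ->
  (forall c mu nu, P mu -> P nu -> P (pprob_convex c mu nu)) ->
  (forall (mu_ : (pprob R)^nat) mu,
    weak_cvg mu_ mu -> (forall n, P (mu_ n)) -> P mu) ->
  forall mu, P mu.
Proof.
move=> Pext Pdirac Pconv Pcvg mu.
have mid : measurable_fun (`[0, +oo[%classic : set R) (@EFin R).
  exact/measurable_EFinP.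
pose g := nnsfun_approx (measurable_itv `[0, +oo[) mid.
apply: (Pcvg (fun n => pprob_distribution mu (g n))).
  apply: weak_cvg_distribution => x x0.
  have : EFin (g n x) @[n --> \oo] --> x%:E.
    apply: cvg_nnsfun_approx; last by rewrite /= in_itv/= x0.
    by move=> y; rewrite /= in_itv/= andbT lee_fin.
  by move/fine_cvgP => [].
move=> n; have [s gs] := (finite_seqP _).1 (@fimfunP _ _ (g n)).
(* The absolute values put the listed points in [{nonneg R}]; they change no value of [g n]. *)
apply: (@pprob_finite_ind _ P Pext Pdirac Pconv [seq `|x|%:nng | x <- s]).
rewrite /= /distribution /pushforward -(probability_setT mu); congr (mu _).
apply/seteqP; split => // x _ /=; rewrite -map_comp.
have gxs : g n x \in s.
  by have : range (g n) (g n x) by []; rewrite gs.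
apply/mapP; exists (g n x) => //=.
by rewrite ger0_norm.
Qed.

End density_of_finitely_supported_measures.

(** * Test functions and the classical convolution *)

Section test_functions.
Context {R : realType}.
Implicit Types (mu nu : pprob R) (F : R -> R).

(** Values in [0, 1] give integrability and access to Tonelli; continuity on the whole line makes
    the class stable under all shifts. *)
Definition test_fun F := continuous F /\ forall x, 0 <= F x <= 1.

Lemma test_fun_measurable F : test_fun F -> measurable_fun setT F.
Proof. by move=> [cF _]; exact: continuous_measurable_fun. Qed.

Lemma test_fun_bounded F (A : set R) : test_fun F -> [bounded F x | x in A].
Proof.
move=> [_ F01]; exists 1; split=> [|M M1 x _]; first exact: num_real.
by have /andP[F0 F1] := F01 x; rewrite /= ger0_norm// (le_trans F1)// ltW.
Qed.

Lemma test_fun_integrable F mu (A : set R) : measurable A -> test_fun F ->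
  mu.-integrable A (EFin \o F).
Proof.
move=> mA tF; apply: measurable_bounded_integrable => //.
- by rewrite (le_lt_trans (probability_le1 _ _)) ?ltry.
- exact: (measurable_funS measurableT _ (test_fun_measurable tF)).
- exact: test_fun_bounded.
Qed.

Lemma weak_cvg_test_fun (mu_ : (pprob R)^nat) mu F : test_fun F ->
  weak_cvg mu_ mu ->
  (\int[mu_ n]_x (F x)%:E @[n --> \oo] --> \int[mu]_x (F x)%:E)%E.
Proof.
move=> tF /(_ F); rewrite integral_pprob; last exact: test_fun_integrable.
under [in X in _ -> X]eq_fun do
  (rewrite integral_pprob; last exact: test_fun_integrable).
apply; last exact: test_fun_bounded.
by apply: continuous_subspaceT; case: tF.
Qed.

(** A continuous approximation of the indicator of []a, +oo[]. *)
Definition ramp (a : R) n (x : R) : R := Num.min 1 (Num.max 0 (n%:R * (x - a))).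

Lemma ramp_test_fun a n : test_fun (ramp a n).
Proof.
split.
  move=> x; apply: (@continuous_min _ _ (cst 1)
    ((cst 0 : R -> R^o) \max (fun x : R => n%:R * (x - a)))).
    exact: cvg_cst.
  apply: (@continuous_max _ _ (cst 0) (fun x : R => n%:R * (x - a))).
    exact: cvg_cst.
  apply: (@cvgM _ _ _ _ (cst n%:R)); first exact: cvg_cst.
  by apply: cvgB; [exact: cvg_id|exact: cvg_cst].
move=> x; rewrite /ramp ge_min lexx/= le_min ler01/= le_max lexx//.
Qed.

Lemma cvg_ramp a x : ramp a n x @[n --> \oo] --> (\1_(`]a, +oo[%classic) x : R).
Proof.
rewrite indicE; have [ax|xa] := ltP a x.
  rewrite mem_set/=; last by rewrite in_itv/= ax.
  have : {near \oo, (fun=> 1 : R) =1 ramp a ^~ x}.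
    near=> n; rewrite /ramp min_l// le_max; apply/orP; right.
    rewrite -ler_pdivrMr ?subr_gt0// div1r; near: n; exact: nbhs_infty_ger.
  by move/near_eq_cvg/cvg_trans; apply; exact: cvg_cst.
rewrite memNset/=; last by rewrite in_itv/= andbT; apply/negP; rewrite -leNgt.
rewrite (_ : (fun n => _) = cst 0); first exact: cvg_cst.
apply/funext => n; rewrite /ramp max_l ?min_r//.
by rewrite mulr_ge0_le0// subr_le0.
Unshelve. all: by end_near. Qed.

(** By dominated convergence the ramps recover the masses of the half-lines []a, +oo[], a generating
    class stable under intersection. *)
Lemma pprob_eq_test_fun mu nu :
  (forall F, test_fun F -> \int[mu]_x (F x)%:E = \int[nu]_x (F x)%:E)%E ->
  mu ≡μ nu.
Proof.
move=> munu; have cvg_tail (rho : pprob R) a :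
    (\int[rho]_x (ramp a n x)%:E @[n --> \oo] --> rho `]a, +oo[%classic)%E.
  have -> : rho `]a, +oo[%classic =
      (\int[rho]_x (\1_(`]a, +oo[%classic) x)%:E)%E.
    by rewrite integral_indic// setIT.
  apply: (@dominated_cvg _ _ _ rho setT _
    (fun n x => (ramp a n x)%:E) _ (fun=> 1%E)) => //.
  - move=> n; apply/measurable_EFinP.
    exact: (test_fun_measurable (ramp_test_fun a n)).
  - move=> x _; apply: cvg_EFin; first exact: nearW.
    exact: cvg_ramp.
  - exact: (finite_measure_integrable_cst rho 1).
  - move=> n x _; have [_ /(_ x)/andP[r0 r1]] := ramp_test_fun a n.
    by rewrite /= lee_fin ger0_norm.
apply: (measure_unique (@RGenOInfty.G R) (fun n => `](- n%:R), +oo[%classic)).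
- exact: RGenOInfty.measurableE.
- move=> _ _ [x ->] [y ->]; exists (Num.max x y).
  by apply/seteqP; split => z /=; rewrite !in_itv/= !andbT gt_max => /andP.
- by move=> n; exists (- n%:R).
- apply/seteqP; split => // x _; exists (Num.bound x) => //=.
  by rewrite in_itv/= andbT ltrNl unstable.ltrNbound.
- move=> _ [a ->]; have := cvg_tail mu a.
  rewrite (_ : (fun n => _) = fun n => (\int[nu]_x (ramp a n x)%:E)%E).
    by move=> munua; exact: (cvg_unique _ munua (cvg_tail nu a)).
  by apply/funext => n; apply/munu/ramp_test_fun.
- by move=> n; rewrite (le_lt_trans (probability_le1 _ _)) ?ltry.
Qed.

(** The dual action of convolution by [nu] on functions. It is real-valued so that it can be a test
    function again. *)
Definition translate_integral nu F (x : R) : R :=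
  (\int[nu]_y F (x + y)).

Lemma test_fun_shift F x : test_fun F -> test_fun (fun y => F (x + y)).
Proof.
move=> [cF F01]; split=> // y.
apply: continuous_comp; last exact: cF.
by apply: cvgD; [exact: cvg_cst|exact: cvg_id].
Qed.

Lemma translate_integralE nu F x : test_fun F ->
  (translate_integral nu F x)%:E = (\int[nu]_y (F (x + y))%:E)%E.
Proof.
move=> tF; rewrite /translate_integral /Rintegral fineK//.
apply: integrable_fin_num => //.
exact/test_fun_integrable/test_fun_shift.
Qed.

(** Continuity passes under the integral with dominating function 1; the bounds hold because [nu]
    has mass 1. *)
Lemma translate_integral_test_fun nu F :
  test_fun F -> test_fun (translate_integral nu F).
Proof.
move=> tF; split=> x.
  apply: (@continuity_under_integral _ _ _ nu (fun x y => F (x + y)) setT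
    measurableT (x - 1) (x + 1) _ _ (cst 1)) => //.
  - by move=> y _; exact/test_fun_integrable/test_fun_shift.
  - apply: aeW => y _ z _; apply: continuous_comp; last first.
      by case: tF => cF _; exact: cF.
    by apply: cvgD; [exact: cvg_id|exact: cvg_cst].
  - exact: (finite_measure_integrable_cst nu 1).
  - move=> y _; apply: aeW => z _ /=.
    by case: tF => _ /(_ (y + z))/andP[F0 F1]; rewrite ger0_norm.
  - by rewrite inE/= in_itv/=; apply/andP; split; lra.
have F0 y z : 0 <= F (y + z) by case: tF => _ /(_ (y + z))/andP[].
rewrite -!lee_fin translate_integralE//; apply/andP; split.
  by apply: integral_ge0 => y _; rewrite lee_fin.
rewrite (_ : 1%E = \int[nu]_y (cst 1%E y))%E; last first.
  by rewrite integral_cst// [X in (_ * X)%E](@probability_setT _ _ _ nu) mule1.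
apply: ge0_le_integral => //.
- by move=> y _; rewrite lee_fin.
- apply/measurable_EFinP; exact: (test_fun_measurable (test_fun_shift x tF)).
- by move=> y _; rewrite lee_fin; case: tF => _ /(_ (x + y))/andP[].
Qed.

Lemma integral_classical_conv_prod mu nu F : test_fun F ->
  (\int[classical_conv mu nu]_x (F x)%:E =
   \int[mu \x nu]_z (F (z.1 + z.2))%:E)%E.
Proof.
move=> tF; rewrite /= /distribution ge0_integral_pushforward//.
- by apply/measurable_EFinP; exact: test_fun_measurable.
- by move=> x _; rewrite lee_fin; case: tF => _ /(_ x)/andP[].
Qed.

Lemma measurable_test_fun_addxy F : test_fun F ->
  measurable_fun setT (fun z : R * R => (F (z.1 + z.2))%:E).
Proof.
move=> tF; apply/measurable_EFinP.
exact: (measurableT_comp (test_fun_measurable tF) measurable_addxy).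
Qed.

(** This duality, a case of Tonelli, carries linearity and weak continuity in [mu] over to the
    classical convolution. *)
Lemma integral_classical_conv mu nu F : test_fun F ->
  (\int[classical_conv mu nu]_x (F x)%:E =
   \int[mu]_x (translate_integral nu F x)%:E)%E.
Proof.
move=> tF; rewrite integral_classical_conv_prod// fubini_tonelli1/=.
- by apply: eq_integral => x _; rewrite translate_integralE.
- exact: measurable_test_fun_addxy.
- by move=> x; rewrite lee_fin; case: tF => _ /(_ (x.1 + x.2))/andP[].
Qed.

(** Tonelli in the other order of integration exchanges the two factors. *)
Lemma classical_convC mu nu : classical_conv mu nu ≡μ classical_conv nu mu.
Proof.
apply: pprob_eq_test_fun => F tF.
rewrite integral_classical_conv_prod// fubini_tonelli2/=.
- rewrite integral_classical_conv//; apply: eq_integral => x _.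
  rewrite translate_integralE//; apply: eq_integral => y _ /=.
  by rewrite addrC.
- exact: measurable_test_fun_addxy.
- by move=> x; rewrite lee_fin; case: tF => _ /(_ (x.1 + x.2))/andP[].
Qed.

End test_functions.

(** * Moments, and the recognition of Dirac measures by them *)

Section moments.
Context {R : realType}.
Implicit Types (mu nu : pprob R) (F : R -> R).

Lemma ge0_integral_pprob_convex (c : {i01 R}) mu nu (D : set R)
    (f : R -> \bar R) :
  measurable D -> measurable_fun D f -> (forall x, D x -> 0 <= f x)%E ->
  (\int[pprob_convex c mu nu]_(x in D) f x =
   c%:num%:E * \int[mu]_(x in D) f x +
   (1 - c%:num)%:E * \int[nu]_(x in D) f x)%E.
Proof.
move=> mD mf f0; rewrite /= /convex_measure ge0_integral_measure_add//.
by rewrite !ge0_integral_mscale.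
Qed.

Lemma eq_pprob_integral mu nu (f : R -> \bar R) (D : set R) :
  mu ≡μ nu -> (\int[mu]_(x in D) f x = \int[nu]_(x in D) f x)%E.
Proof. by move=> munu; apply: eq_measure_integral => A mA _; exact: munu. Qed.

Lemma eq_moment mu nu n : mu ≡μ nu -> moment mu n = moment nu n.
Proof. exact: eq_pprob_integral. Qed.

Lemma measurable_exprE (D : set R) n :
  measurable_fun D (fun x : R => (x ^+ n)%:E).
Proof. by apply/measurable_EFinP; exact: exprn_measurable. Qed.

Lemma moment_ge0 mu n : (0 <= moment mu n)%E.
Proof.
apply: integral_ge0 => x; rewrite /= in_itv/= andbT => x0.
by rewrite lee_fin exprn_ge0.
Qed.

Lemma moment0 mu : moment mu 0 = 1%E.
Proof.
rewrite /moment; under eq_integral do rewrite expr0.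
by rewrite integral_cst//= mul1e pprobP.
Qed.

Lemma moment_dirac a n : moment (pprob_dirac a) n = (a%:num ^+ n : R)%:E.
Proof.
rewrite /moment /= integral_dirac//; last exact: measurable_exprE.
by rewrite diracE mem_set ?mul1e//= in_itv/= andbT.
Qed.

Lemma moment_convex c mu nu n : moment (pprob_convex c mu nu) n =
  (c%:num%:E * moment mu n + (1 - c%:num)%:E * moment nu n)%E.
Proof.
apply: ge0_integral_pprob_convex => //; first exact: measurable_exprE.
by move=> x; rewrite /= in_itv/= andbT => x0; rewrite lee_fin exprn_ge0.
Qed.

(** With moments [m1] and [m2], the integral of [(x - s)^2] is [m2 - 2 s m1 + s^2 = 0], so [x = s]
    almost everywhere. *)
Lemma moment12_dirac mu (s : {nonneg R}) :
  moment mu 1 = s%:num%:E -> moment mu 2 = (s%:num ^+ 2)%:E ->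
  mu ≡μ pprob_dirac s.
Proof.
move=> m1 m2; apply: pprob_eq_dirac.
have mq : measurable_fun (`[0, +oo[%classic : set R)
    (fun x => ((x - s%:num) ^+ 2)%:E).
  apply/measurable_EFinP; apply: measurable_funX.
  exact: measurable_funB.
have var0 : (\int[mu]_(x in `[0%R, +oo[) ((x - s%:num) ^+ 2)%:E = 0)%E.
  (* Stated without subtraction, so that every integrand is nonnegative. *)
  have : (\int[mu]_(x in `[0%R, +oo[)
        (((x - s%:num) ^+ 2)%:E + (2 * s%:num)%:E * (x ^+ 1)%:E) =
      \int[mu]_(x in `[0%R, +oo[) ((x ^+ 2)%:E + (s%:num ^+ 2)%:E))%E.
    apply: eq_integral => x _; rewrite -EFinM -!EFinD; congr (_%:E); ring.
  have mX n := @measurable_exprE (`[0, +oo[%classic : set R) n.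
  have X0 n x : (`[0, +oo[%classic : set R) x -> (0 <= (x ^+ n)%:E)%E.
    by rewrite /= in_itv/= andbT lee_fin => /exprn_ge0; exact.
  have s0 x : (`[0, +oo[%classic : set R) x ->
      (0 <= (2 * s%:num)%:E * (x ^+ 1)%:E)%E.
    by move=> x0; rewrite mule_ge0//; exact: X0.
  rewrite ge0_integralD//; last 2 first.
  - by move=> x _; rewrite lee_fin sqr_ge0.
  - exact: measurable_funeM.
  rewrite ge0_integralD//; last first.
    by move=> x _; rewrite lee_fin sqr_ge0.
  rewrite ge0_integralZl//; last first.
    exact: (X0 1%N).
  rewrite -/(moment mu 1) -/(moment mu 2) m1 m2 integral_cst//=.
  rewrite pprobP mule1.
  case: (integral _ _ _) => // r; rewrite -EFinM -!EFinD => -[H].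
  congr (_%:E); lra.
have [N [mN N0 DN]] : ae_eq mu `[0, +oo[%classic
    (fun x => ((x - s%:num) ^+ 2)%:E) (cst 0%E).
  apply/ae_eq_integral_abs => //.
  by under eq_integral => x _ do rewrite gee0_abs ?lee_fin ?sqr_ge0//.
have : mu (~` [set s%:num]) = 0%E.
  (* The almost-everywhere equality concerns R_+ only, so the negative half-line is added as a
     second null set. *)
  apply: (@subset_measure0 _ _ _ mu _ (N `|` `]-oo, 0[%classic)).
  - exact: measurableC.
  - exact: measurableU.
  - move=> x /= xs; have [x0|x0] := ltP x 0; first by right; rewrite /= in_itv.
    left; apply: DN => /= /(_ _); rewrite in_itv/= x0 => /(_ isT) [] /eqP.
    by rewrite expf_eq0/= subr_eq0 => /eqP.
  - by apply: null_set_setU => //; exact: pprob_setN.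
rewrite probability_setC//.
have : mu [set s%:num] \is a fin_num by exact: fin_num_measure.
by case: (mu _) => // r _; rewrite -EFinB => -[/eqP]; rewrite subr_eq0 => /eqP <-.
Qed.

End moments.

(** * The multinomial formula for two factors *)

Lemma sum_ffun2 (R : nzRingType) n (f : nat -> nat -> R) :
  \sum_(m : {ffun 'I_2 -> 'I_n.+1} | (\sum_(i < 2) m i == n)%N)
     f (m ord0) (m ord_max) = \sum_(i < n.+1) f i (n - i)%N.
Proof.
(* A pair of sum [n] is determined by its first entry [i]; [rev_ord i] is the second one,
   [n - i]. *)
pose h (i : 'I_n.+1) := [ffun j : 'I_2 => if j == ord0 then i else rev_ord i].
rewrite (reindex_onto h (fun m => m ord0)) /=.
  apply: eq_big => i; last by rewrite !ffunE.
  rewrite !big_ord_recl big_ord0 !ffunE /= addn0 subSS subnKC ?eqxx//.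
  by rewrite -ltnS ltn_ord.
move=> m; rewrite !big_ord_recl big_ord0 addn0 => /eqP mn.
apply/ffunP => j; rewrite ffunE; case: ifPn => [/eqP->//|].
move=> j0; apply/val_inj; rewrite /= subSS.
have -> : j = lift ord0 ord0 by apply/val_inj => /=; case: j j0 => -[|[]].
by apply/(@addnI (m ord0)); rewrite mn subnKC// -ltnS ltn_ord.
Qed.

(** * Comparison of a multinomial convolution with the classical one *)

Section multinomial_generalised_convolution.
Context {R : realType} (op : pprob R -> pprob R -> pprob R).
Context (op_gc : generalised_convolution op).
Context (op_multinomial : multinomial_conv op).
Implicit Types (mu nu : pprob R).

(** The case [k = 2], in which [conv_pow op mu 2] computes to [op mu mu] and the multinomial sum
    becomes binomial. *)
Lemma moment_op_square mu n : (forall k, moment mu k < +oo)%E ->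
  moment (op mu mu) n = (\sum_(i < n.+1)
    n`!%:R / (i`! * (n - i)`!)%:R *
    (fine (moment mu i) * fine (moment mu (n - i))))%:E.
Proof.
move=> muoo; have /= -> := op_multinomial muoo 2 n; congr (_%:E).
rewrite -(sum_ffun2 n (fun i j => n`!%:R / (i`! * j`!)%:R *
  (fine (moment mu i) * fine (moment mu j)))).
apply: eq_bigr => m _; rewrite !big_ord_recl !big_ord0 !mulr1 natrM.
rewrite (_ : lift ord0 ord0 = ord_max)//; exact: val_inj.
Qed.

Lemma moment1_op_square mu : (forall k, moment mu k < +oo)%E ->
  moment (op mu mu) 1 = (2 * fine (moment mu 1))%:E.
Proof.
move=> muoo; rewrite moment_op_square// !big_ord_recl big_ord0 /= moment0.
set m := fine (moment mu 1).
(* The factorials are evaluated by conversion, leaving numerals for [field]. *)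
change ((1%:R / 1%:R * (1 * m) + (1%:R / 1%:R * (m * 1) + 0))%:E = (2 * m)%:E).
by congr (_%:E); field.
Qed.

Lemma moment2_op_square mu : (forall k, moment mu k < +oo)%E ->
  moment (op mu mu) 2 =
    (2 * fine (moment mu 2) + 2 * fine (moment mu 1) ^+ 2)%:E.
Proof.
move=> muoo; rewrite moment_op_square// !big_ord_recl big_ord0 /= moment0.
set m1 := fine (moment mu 1); set m2 := fine (moment mu 2).
change ((2%:R / 2%:R * (1 * m2) + (2%:R / 1%:R * (m1 * m1) +
  (2%:R / 2%:R * (m2 * 1) + 0)))%:E = (2 * m2 + 2 * m1 ^+ 2)%:E).
by congr (_%:E); field.
Qed.

Lemma op_dirac_dirac (a b : {nonneg R}) :
  op (pprob_dirac a) (pprob_dirac b) ≡μ pprob_dirac (a%:num + b%:num)%:nng.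
Proof.
have Doo c k : (moment (pprob_dirac c : pprob R) k < +oo)%E.
  by rewrite moment_dirac ltry.
have [c cE] : exists c : {i01 R}, c%:num = 2^-1.
  by apply: i01_exists; rewrite invr_ge0 ler0n/= invf_le1// ler1n.
have c'E : 1 - c%:num = 2^-1 by rewrite cE; field.
pose mu := pprob_convex c (pprob_dirac a) (pprob_dirac b).
have muM k : moment mu k = (2^-1 * a%:num ^+ k + 2^-1 * b%:num ^+ k)%:E.
  by rewrite moment_convex !moment_dirac c'E cE.
have muoo k : (moment mu k < +oo)%E by rewrite muM ltry.
(* Distributivity is available in the left argument; commutativity moves the convex sum there. *)
have opl d n : moment (op (pprob_dirac d) mu) n =
    (2^-1%:E * moment (op (pprob_dirac a) (pprob_dirac d)) n +
     2^-1%:E * moment (op (pprob_dirac b) (pprob_dirac d)) n)%E.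
  rewrite (eq_moment n (gc_comm op_gc _ _)).
  rewrite (eq_moment n (gc_convex op_gc _ _ _ _)).
  by rewrite moment_convex c'E cE.
have opmu n : moment (op mu mu) n =
    (2^-1%:E * moment (op (pprob_dirac a) mu) n +
     2^-1%:E * moment (op (pprob_dirac b) mu) n)%E.
  rewrite (eq_moment n (gc_convex op_gc _ _ _ _)).
  by rewrite moment_convex c'E cE.
(* Polarisation: [r = (A + 2 X + B) / 4] is solved for the mixed moment [X], where [A = (2 a)^n] and
   [B = (2 b)^n] are the moments of the two squares. *)
have opab n (r : R) : moment (op mu mu) n = r%:E ->
    moment (op (pprob_dirac a) (pprob_dirac a)) n = ((2 * a%:num) ^+ n)%:E ->
    moment (op (pprob_dirac b) (pprob_dirac b)) n = ((2 * b%:num) ^+ n)%:E ->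
    moment (op (pprob_dirac a) (pprob_dirac b)) n =
      (2 * r - 2^-1 * ((2 * a%:num) ^+ n + (2 * b%:num) ^+ n))%:E.
  rewrite opmu !opl => opr aE bE; move: opr; rewrite aE bE.
  rewrite (eq_moment n (gc_comm op_gc (pprob_dirac b) _)).
  (* The mixed moment could a priori be infinite: nonnegativity excludes [-oo], and the finiteness
     of [r] excludes [+oo]. *)
  have := moment_ge0 (op (pprob_dirac a) (pprob_dirac b)) n.
  case: (moment _ _) => [x _| |]//.
    by rewrite -!EFinM -!EFinD => -[H]; congr (_%:E); lra.
  by rewrite gt0_muley ?lte_fin// addye// addey// gt0_muley ?lte_fin// addye.
(* Here [r = a + b] for [n = 1] and [r = a^2 + b^2 + (a + b)^2 / 2] for [n = 2], so the mixed
   moments are [a + b] and [(a + b)^2]. *)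
apply: moment12_dirac => /=.
  rewrite (opab _ _ (moment1_op_square muoo))
    ?moment1_op_square ?muM ?moment_dirac//=.
  by congr (_%:E); field.
rewrite (opab _ _ (moment2_op_square muoo))
  ?moment2_op_square ?muM ?moment_dirac//=.
- by congr (_%:E); field.
- by congr (_%:E); ring.
- by congr (_%:E); ring.
Qed.

Lemma classical_conv_dirac_dirac (a b : {nonneg R}) :
  classical_conv (pprob_dirac a) (pprob_dirac b) ≡μ
    pprob_dirac (a%:num + b%:num)%:nng.
Proof.
have int_dirac (c : {nonneg R}) (F : R -> R) : test_fun F ->
    (\int[pprob_dirac c]_x (F x)%:E = (F c%:num)%:E)%E.
  move=> tF; rewrite /= integral_dirac// ?diracT ?mul1e//.
  by apply/measurable_EFinP; exact: test_fun_measurable.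
apply: pprob_eq_test_fun => F tF.
rewrite integral_classical_conv// !int_dirac//; last first.
  exact: translate_integral_test_fun.
rewrite translate_integralE//.
rewrite (int_dirac b (fun y => F (a%:num + y)))//.
exact: test_fun_shift.
Qed.

(** For fixed [nu], the measures [mu] on which both products agree are closed under convex sums and
    weak limits, so [pprob_ind] applies. *)
Lemma op_classical_ind nu :
  (forall a, op (pprob_dirac a) nu ≡μ classical_conv (pprob_dirac a) nu) ->
  forall mu, op mu nu ≡μ classical_conv mu nu.
Proof.
move=> opdirac; apply: pprob_ind => //.
- move=> mu mu' mumu' opmu A mA.
  have <- := gc_ext op_gc mumu' (fun _ _ => erefl) mA; rewrite opmu//.
  apply: pprob_eq_test_fun A mA => F tF.
  by rewrite !integral_classical_conv//; exact: eq_pprob_integral.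
- move=> c mu1 mu2 op1 op2; apply: pprob_eq_test_fun => F tF.
  have tF01 (G : R -> R) : test_fun G -> measurable_fun setT (EFin \o G) /\
      (forall x, setT x -> 0 <= (G x)%:E)%E.
    move=> tG; split.
      by apply/measurable_EFinP; exact: test_fun_measurable.
    by move=> x _; rewrite lee_fin; case: tG => _ /(_ x)/andP[].
  have [mF F0] := tF01 _ tF.
  have [mG G0] := tF01 _ (translate_integral_test_fun nu tF).
  rewrite (eq_pprob_integral _ _ (gc_convex op_gc _ _ _ _)).
  rewrite integral_classical_conv// !ge0_integral_pprob_convex//.
  rewrite (eq_pprob_integral _ _ op1) (eq_pprob_integral _ _ op2).
  by rewrite !integral_classical_conv.
- move=> mu_ mu mu_mu opmu_; apply: pprob_eq_test_fun => F tF.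
  have nunu : weak_cvg (fun=> nu) nu by move=> f _ _; exact: cvg_cst.
  (* The same sequence of integrals has two limits: one by weak continuity of [op], the other
     because [translate_integral nu F] is itself a test function. *)
  have opcvg := weak_cvg_test_fun tF (gc_weak_cvg op_gc mu_mu nunu).
  have convcvg := weak_cvg_test_fun (translate_integral_test_fun nu tF) mu_mu.
  rewrite integral_classical_conv//.
  move: opcvg; rewrite (_ : (fun n => _) =
      fun n => (\int[mu_ n]_x (translate_integral nu F x)%:E)%E).
    by move=> opcvg; exact: (cvg_unique _ opcvg convcvg).
  apply/funext => n; rewrite (eq_pprob_integral _ _ (opmu_ n)).
  exact: integral_classical_conv.
Qed.

(** Each use of [op_classical_ind] reduces one argument to a Dirac measure; commutativity exchanges
    the arguments in between. *)
Lemma multinomial_conv_classical mu nu : op mu nu ≡μ classical_conv mu nu.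
Proof.
apply: op_classical_ind => a A mA.
rewrite (gc_comm op_gc)// classical_convC//.
apply: op_classical_ind A mA => b A mA.
by rewrite op_dirac_dirac// classical_conv_dirac_dirac.
Qed.

End multinomial_generalised_convolution.

Theorem proposition3p1 (R : realType) (op : pprob R -> pprob R -> pprob R) :
  generalised_convolution op ->
  ~ (forall mu nu : pprob R, op mu nu ≡μ classical_conv mu nu) ->
  ~ multinomial_conv op.
Proof.
by move=> op_gc not_classical /(multinomial_conv_classical op_gc).
Qed.
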